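(* Let $m\ge 1$ be an integer. For $M\in\{\mathbb{R}^{m+1},S^m,\mathbb{R}P^m\}$ and positive integers $k\le n$, let $\pi:W_{k,n+1}(M)\rightarrow W_{k,n}(M)$ be the map defined by \[ \pi(p_1,\dots,p_n,p_{n+1})=(p_1,\dots,p_n). \] (1) Let $M=\mathbb{R}^{m+1}$ or $M=S^m$. If $k=n=m$ or $k=n=m+1$, then $\pi:W_{k,n+1}(M)\rightarrow W_{k,n}(M)$ is a fiber bundle with fiber $M-Q_{k-1,k}(M)_{b_k}$, and this fiber bundle admits a cross-section. (2) Let $M=\mathbb{R}P^m$. If $k+1=n=m+2$, then $\pi:W_{k,n+1}(\mathbb{R}P^m)\rightarrow W_{k,n}(\mathbb{R}P^m)$ is a fiber bundle with fiber $\mathbb{R}P^m-Q_{m,m+2}(\mathbb{R}P^m)_{([e_1],\dots,[e_{m+1}],[e_1+\cdots+e_{m+1}])}$.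
   Context: Here $S^m\subset\mathbb{R}^{m+1}$ is the unit sphere and $\mathbb{R}P^m=P(\mathbb{R}^{m+1})$ is the real projective space; $[v]$ denotes the class in $\mathbb{R}P^m$ of a nonzero vector $v$. Points $[v_1],\dots,[v_k]$ of a projective space are called linearly independent if the vectors $v_1,\dots,v_k$ are linearly independent (and linearly dependent otherwise). Generalized configuration space: for $M$ a subset of a vector space or of a projective space and $n\ge k\ge 1$, \[ W_{k,n}(M)=\{(p_1,\dots,p_n)\in M^n \mid \text{for every } k\text{-element subset } \{i_1,\dots,i_k\}\subset\{1,\dots,n\},\ p_{i_1},\dots,p_{i_k}\text{ are linearly independent}\}, \] with the topology induced from $M^n$. For $p=(p_1,\dots,p_n)\in W_{k,n}(M)$ and $\{i_1,\dots,i_{k-1}\}\subset\{1,\dots,n\}$ a $(k-1)$-element subset, put \[ Q_n^{i_1,\dots,i_{k-1}}(M)_p=\{x\in M\mid x,p_{i_1},\dots,p_{i_{k-1}}\text{ are linearly dependent}\}, \] and $Q_{k-1,n}(M)_p=\bigcup_{\{i_1,\dots,i_{k-1}\}\subset\{1,\dots,n\}}Q_n^{i_1,\dots,i_{k-1}}(M)_p$. $e_1,\dots,e_{m+1}$ are the standard basis vectors of $\mathbb{R}^{m+1}$ and $b_k=(e_1,\dots,e_k)$. *)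

(* Defs.v *)
From HB Require Import structures.
From mathcomp Require Import all_boot all_order all_algebra.
From mathcomp Require Import generic_quotient.
From mathcomp Require Import all_classical all_reals all_analysis.
Import Order.TTheory GRing.Theory Num.Theory.
Import numFieldNormedType.Exports.

Set Implicit Arguments.
Unset Strict Implicit.
Unset Printing Implicit Defensive.

Local Open Scope classical_set_scope.
Local Open Scope ring_scope.
Local Open Scope quotient_scope.

Definition set_elt (T : Type) (A : set T) (x : T) (Ax : A x) : A :=
  @exist T (fun y => y \in A) x (mem_set Ax).

Definition homeomorphism (X Y : topologicalType) (f : X -> Y) : Prop :=
  continuous f /\
  exists g : Y -> X, [/\ continuous g, cancel f g & cancel g f].

(* A set used as a type, such as [p @^-1` U] below, is coerced to the subtype
   [set_type], whose topology is the subspace topology. *)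
Definition fiber_bundle (E B F : topologicalType) (p : E -> B) : Prop :=
  [/\ continuous p,
      (forall b : B, exists x : E, p x = b) &
      forall b : B, exists U : set B, [/\ open U, U b &
        exists h : (p @^-1` U) -> (U * F)%type,
          homeomorphism h /\ (forall x, \val (h x).1 = p (\val x))]].

Definition cross_section (E B : topologicalType) (p : E -> B) (s : B -> E) :
  Prop := continuous s /\ forall b, p (s b) = b.

(* [indep] is linear independence of a finite family of points of [T]: [vfree]
   for vectors, [pfree] below for points of the projective space. *)
Section Configurations.
Context {T : topologicalType}.
Variable indep : seq T -> bool.

(* [{ptws 'I_n -> T}] is [T^n] with the product topology. *)
Definition W (k n : nat) (M : set T) : set {ptws 'I_n -> T} :=
  [set p | (forall i, M (p i)) /\
     forall I : {set 'I_n}, #|I| = k -> indep [seq p i | i <- enum I]].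
Arguments W : clear implicits.

Definition Qspan (n : nat) (M : set T) (p : 'I_n -> T) (I : {set 'I_n}) :
    set T :=
  [set x | M x /\ ~~ indep (x :: [seq p i | i <- enum I])].

(* [j] is the cardinality of the index sets: $Q_{k-1,n}(M)_p$ is
   [Q k.-1 M p]. *)
Definition Q (j n : nat) (M : set T) (p : 'I_n -> T) : set T :=
  \bigcup_(I in [set I : {set 'I_n} | #|I| = j]) Qspan M p I.

Definition drop_last (n : nat) (p : {ptws 'I_n.+1 -> T}) : {ptws 'I_n -> T} :=
  fun i => p (widen_ord (leqnSn n) i).

Lemma drop_last_W (k n : nat) (M : set T) (p : {ptws 'I_n.+1 -> T}) :
  W k n.+1 M p -> W k n M (drop_last p).
Proof.
case=> Mp Ip; split=> [i|I cI]; first exact: Mp.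
pose w := widen_ord (leqnSn n).
have w_inj : injective w by move=> i j /(congr1 val)/= /val_inj.
have := Ip (w @: I)%SET; rewrite card_imset // => /(_ cI).
suff -> : enum (w @: I)%SET = [seq w i | i <- enum I] by rewrite -map_comp.
rewrite {1}/enum_mem -enumT /= enum_ordSr filter_rcons /=.
have -> : ord_max \in (w @: I)%SET = false.
  apply/negbTE/negP => /imsetP[i _ /(congr1 val)/= ni].
  by have := ltn_ord i; rewrite -ni ltnn.
rewrite filter_map; congr map.
rewrite [in RHS]/enum_mem -enumT; apply: eq_filter => i /=.
by rewrite mem_imset.
Qed.

Definition W_proj (k n : nat) (M : set T) (p : W k n.+1 M) : W k n M :=
  set_elt (drop_last_W (set_mem (valP p))).

End Configurations.
Arguments W {T} indep k n M.
Arguments W_proj {T} indep k n M.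

Definition sphere (R : realType) (m : nat) : set 'rV[R]_m.+1 :=
  [set x | \sum_(i < m.+1) x 0 i ^+ 2 = 1].
Arguments sphere R m : clear implicits.

Definition vfree (R : realType) (m : nat) (s : seq 'rV[R]_m.+1) : bool := free s.
Arguments vfree {R m} s.

Section Projective.
Variables (R : realType) (m : nat).

Definition nzvec := set_type [set v : 'rV[R]_m.+1 | v != 0].
HB.instance Definition _ :=
  Topological.copy nzvec (set_type [set v : 'rV[R]_m.+1 | v != 0]).

Definition same_line (u v : nzvec) : bool := (<[\val u]> == <[\val v]>)%VS.

Lemma same_line_equiv : equiv_class_of same_line.
Proof.
split=> [u|u v|v u w]; rewrite /same_line //.
by move=> /eqP-> /eqP->.
Qed.

Definition same_line_rel := EquivRelPack same_line_equiv.

Definition RP := quotient_topology {eq_quot same_line_rel}.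
HB.instance Definition _ := Quotient.on RP.
HB.instance Definition _ := Topological.on RP.

Definition proj (v : 'rV[R]_m.+1) (v0 : v != 0) : RP :=
  \pi_RP (set_elt (A := [set v : 'rV[R]_m.+1 | v != 0]) v0).

(* Linear independence is checked on chosen representatives; [pfree_pi] shows
   that the choice does not matter. *)
Definition pfree (s : seq RP) : bool := free [seq \val (repr x) | x <- s].

Lemma pfree_pi (s : seq nzvec) :
  pfree [seq \pi_RP v | v <- s] = free [seq \val v | v <- s].
Proof.
have line v : (<[\val (repr (\pi_RP v))]> = <[\val v]>)%VS.
  pose x := repr (\pi_RP v).
  have /eqP : x = v %[mod {eq_quot same_line_rel}] by exact: reprK.
  by rewrite eqmodE => /eqP.
rewrite /pfree -map_comp; elim: s => //= v s IHs.
rewrite !free_cons IHs; congr (~~ _ && _).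
rewrite !memvE line; congr (_ <= _)%VS.
by elim: s {IHs} => //= u s IHs; rewrite !span_cons IHs line.
Qed.

Definition e_ (i : 'I_m.+1) : 'rV[R]_m.+1 := delta_mx 0 i.

(* For [k <= m.+1], [inord] is here the inclusion of ['I_k] in ['I_m.+1]. *)
Definition b_ (k : nat) : 'I_k -> 'rV[R]_m.+1 := fun i => e_ (inord i).

Lemma e_neq0 i : e_ i != 0.
Proof.
by apply/eqP => /matrixP/(_ 0 i)/eqP; rewrite !mxE !eqxx oner_eq0.
Qed.

Lemma sum_e_neq0 : \sum_i e_ i != 0.
Proof.
apply/eqP => /matrixP/(_ 0 ord0)/eqP; rewrite summxE (bigD1 ord0) //=.
rewrite big1 => [|i i0]; rewrite !mxE !eqxx ?addr0 ?oner_eq0 //.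
by rewrite eq_sym (negbTE i0).
Qed.

Definition std_frame : 'I_m.+2 -> RP :=
  fun i => if unlift ord_max i is Some j then proj (e_neq0 j)
           else proj sum_e_neq0.

End Projective.
Arguments RP R m : clear implicits.
Arguments b_ R m k : clear implicits.
Arguments std_frame R m : clear implicits.
Arguments pfree {R m} s.

(* Main.v *)
Require Import Defs.
From mathcomp Require Import all_boot all_order all_algebra.
From mathcomp Require Import generic_quotient.
From mathcomp Require Import all_classical all_reals all_analysis.
Import Order.TTheory GRing.Theory Num.Theory.
Import numFieldNormedType.Exports.

(** Every projection here is trivialized locally by linear changes of frame.
    Suppose that near a configuration [p0] each configuration [p] comes with a
    transformation [alpha p] of the ambient space that depends continuously on
    [p], preserves linear independence, and carries a fixed standard
    configuration [b] to [p]. Then [alpha p] maps the points in general position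
    with respect to [b] onto those in general position with respect to [p], and
    the fiber of the projection over [p] consists exactly of the latter points
    ([W_addP]). Hence [(p, x) |-> (p, alpha p x)] is a local trivialization
    ([fiber_bundle_of_charts]), and the theorem reduces to the construction of
    such transformations.

    For vectors, complete the independent family [p0] to a basis by fixed
    vectors. The same vectors complete every nearby [p], since the determinant
    is continuous, and the matrix with these rows carries the standard basis to
    the completed family ([vector_chart]). The argument covers every number [k
    <= m.+1] of vectors. On the sphere the linear map is followed by the
    normalization of vectors, which changes no line and hence no independence
    relation. The sum of the [k] vectors is independent of any [k.-1] of them
    ([sum_free]), so that appending the (normalized) sum is a cross-section.

    For points of the projective space, choose representatives [v_i] that
    depend continuously on the points: near a given line, a suitable row of
    the matrix of the orthogonal projection onto the line spans it
    ([lift_row]). General position says that the first [m.+1] vectors form a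
    basis and that all coordinates [c_i] of the last vector in this basis are
    nonzero. The matrix with rows [c_i v_i] then carries the standard
    projective frame to the given points ([frame_mx], [projective_chart]).
    The fiber is nonempty because the class of the vector (1, 2, ..., m + 1)
    is in general position with respect to the standard frame
    ([staircase_free]). *)

Local Open Scope classical_set_scope.
Local Open Scope ring_scope.

Set Implicit Arguments.
Unset Strict Implicit.
Unset Printing Implicit Defensive.

(** * Limits of configurations and matrices *)

Section Limits.
Context {S : Type} {F : set_system S} {FF : Filter F}.

Lemma cvg_mx (T : topologicalType) (m n : nat) (f : S -> 'M[T]_(m, n))
    (A : 'M[T]_(m, n)) :
  (forall i j, f x i j @[x --> F] --> A i j) -> f x @[x --> F] --> A.
Proof.
move=> fA B [P PA PB]; rewrite nbhs_simpl /=.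
suff : F [set x | forall i j, P i j (f x i j)].
  by apply: filterS => x Px; exact: PB.
by apply: filter_forall => i; apply: filter_forall => j; exact: fA.
Qed.

Lemma cvg_ptws (I : Type) (T : topologicalType) (f : S -> {ptws I -> T})
    (p : {ptws I -> T}) :
  (forall i, f x i @[x --> F] --> p i) -> f x @[x --> F] --> p.
Proof.
move=> fp; apply/cvg_sup => i A [_ [[B oB <-] Bp BA]].
rewrite nbhs_simpl /=.
have : nbhs (p i) B by exact: open_nbhs_nbhs.
move=> /fp /= fB.
by apply: (@filterS _ F _ _ _ _ fB) => x /= fxB; exact: BA.
Qed.

Lemma cvg_ptws_coord (I : eqType) (T : topologicalType) (f : S -> {ptws I -> T})
    (p : {ptws I -> T}) i : f x @[x --> F] --> p -> f x i @[x --> F] --> p i.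
Proof.
move=> fp.
apply: (@continuous_cvg _ _ _ F _ f (fun q : {ptws I -> T} => q i) p) => //.
exact: (@proj_continuous _ (fun=> T)).
Qed.

Lemma cvg_set_type (T : topologicalType) (A : set T) (f : S -> A) (a : A) :
  \val (f x) @[x --> F] --> \val a -> f x @[x --> F] --> a.
Proof.
move=> fa B [_ [[C oC <-] Ca CB]]; rewrite nbhs_simpl /=.
have : nbhs (\val a) C by exact: open_nbhs_nbhs.
by move=> /fa /= fC; apply: (@filterS _ F _ _ _ _ fC) => x /= fxC; exact: CB.
Qed.

Lemma cvg_val (T : topologicalType) (A : set T) (f : S -> A) (a : A) :
  f x @[x --> F] --> a -> \val (f x) @[x --> F] --> \val a.
Proof.
move=> fa.
apply: (@continuous_cvg _ _ _ F _ f (fun x : A => \val x) a) => //.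
exact: initial_continuous.
Qed.

Variable R : realType.

Lemma cvg_sumr (I : Type) (r : seq I) (P : pred I) (f : I -> S -> R)
    (a : I -> R) :
  (forall i, P i -> f i x @[x --> F] --> a i) ->
  \sum_(i <- r | P i) f i x @[x --> F] --> \sum_(i <- r | P i) a i.
Proof. by move=> fa; apply: cvg_big => //; exact: add_continuous. Qed.

Lemma cvg_prodr (I : Type) (r : seq I) (P : pred I) (f : I -> S -> R)
    (a : I -> R) :
  (forall i, P i -> f i x @[x --> F] --> a i) ->
  \prod_(i <- r | P i) f i x @[x --> F] --> \prod_(i <- r | P i) a i.
Proof. by move=> fa; apply: cvg_big => //; exact: mul_continuous. Qed.

Lemma cvg_coord (m n : nat) (f : S -> 'M[R]_(m, n)) (A : 'M[R]_(m, n)) i j :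
  f x @[x --> F] --> A -> f x i j @[x --> F] --> A i j.
Proof.
move=> fA.
apply: (@continuous_cvg _ _ _ F _ f (fun M : 'M[R]_(m, n) => M i j) A) => //.
exact: coord_continuous.
Qed.

Lemma cvg_mulmx (m n p : nat) (f : S -> 'M[R]_(m, n)) (g : S -> 'M[R]_(n, p))
    (A : 'M[R]_(m, n)) (B : 'M[R]_(n, p)) :
  f x @[x --> F] --> A -> g x @[x --> F] --> B ->
  (f x *m g x) @[x --> F] --> A *m B.
Proof.
move=> fA gB; apply: cvg_mx => i j; rewrite mxE.
under eq_fun do rewrite mxE.
by apply: cvg_sumr => k _; apply: cvgM; exact: cvg_coord.
Qed.

Lemma cvg_det (n : nat) (f : S -> 'M[R]_n) (A : 'M[R]_n) :
  f x @[x --> F] --> A -> \det (f x) @[x --> F] --> \det A.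
Proof.
move=> fA; apply: cvg_sumr => s _; apply: cvgM; first exact: cvg_cst.
by apply: cvg_prodr => i _; exact: cvg_coord.
Qed.

Lemma cvg_adj (n : nat) (f : S -> 'M[R]_n) (A : 'M[R]_n) :
  f x @[x --> F] --> A -> \adj (f x) @[x --> F] --> \adj A.
Proof.
move=> fA; apply: cvg_mx => i j; rewrite mxE.
under eq_fun do rewrite mxE.
apply: cvgM; first exact: cvg_cst.
apply: cvg_det; apply: cvg_mx => k l; rewrite !mxE.
by under eq_fun do rewrite !mxE; exact: cvg_coord.
Qed.

Lemma cvg_scalemx (m n : nat) (c : S -> R) (f : S -> 'M[R]_(m, n)) (a : R)
    (A : 'M[R]_(m, n)) :
  c x @[x --> F] --> a -> f x @[x --> F] --> A ->
  (c x *: f x) @[x --> F] --> a *: A.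
Proof.
move=> ca fA; apply: cvg_mx => i j; rewrite mxE.
by under eq_fun do rewrite mxE; apply: cvgM => //; exact: cvg_coord.
Qed.

Lemma near_neq0 (f : S -> R) (a : R) :
  a != 0 -> f x @[x --> F] --> a -> \forall x \near F, f x != 0.
Proof.
move=> a0 fa; have : nbhs a [set y | y != 0].
  by apply: open_nbhs_nbhs; split=> //; exact: open_neq.
by move/fa.
Qed.

Lemma near_mx_neq0 (m n : nat) (f : S -> 'M[R]_(m, n)) (A : 'M[R]_(m, n)) :
  A != 0 -> f x @[x --> F] --> A -> \forall x \near F, f x != 0.
Proof.
move=> /matrix0Pn[i [j Aij]] fA.
apply: (@filterS _ F _ _ _ _ (near_neq0 Aij (cvg_coord fA))) => x /=.
by apply: contraNneq => ->; rewrite mxE.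
Qed.

Lemma near_unitmx (n : nat) (f : S -> 'M[R]_n) (A : 'M[R]_n) :
  A \in unitmx -> f x @[x --> F] --> A -> \forall x \near F, f x \in unitmx.
Proof.
rewrite unitmxE unitfE => dA fA.
apply: (@filterS _ F _ _ _ _ (near_neq0 dA (cvg_det fA))) => x /=.
by rewrite unitmxE unitfE.
Qed.

Lemma cvg_invmx (n : nat) (f : S -> 'M[R]_n) (A : 'M[R]_n) :
  A \in unitmx -> f x @[x --> F] --> A -> invmx (f x) @[x --> F] --> invmx A.
Proof.
move=> uA fA; have fu := near_unitmx uA fA.
rewrite /invmx uA.
(* [invmx] agrees with Cramer's formula only where the determinant is nonzero,
   hence only near [A]. *)
have : ((\det (f x))^-1 *: \adj (f x)) @[x --> F] --> (\det A)^-1 *: \adj A.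
  apply: cvg_scalemx; last exact: cvg_adj.
  by apply: cvgV; [rewrite -unitfE -unitmxE|exact: cvg_det].
apply: cvg_trans; apply: near_eq_cvg.
by apply: filterS fu => x /= ->.
Qed.

End Limits.

(** * Local triviality from continuous changes of frame *)

Section Configurations.
Context {T : topologicalType}.
Variable indep : seq T -> bool.
Hypothesis perm_indep : forall s t, perm_eq s t -> indep s = indep t.

Definition add_last (n : nat) (p : {ptws 'I_n -> T}) (x : T) :
    {ptws 'I_n.+1 -> T} :=
  fun i => if unlift ord_max i is Some j then p j else x.

Lemma widen_ord_lift n (i : 'I_n) : widen_ord (leqnSn n) i = lift ord_max i.
Proof. by apply: val_inj; rewrite /= /bump leqNgt ltn_ord. Qed.

Lemma add_last_lift n (p : {ptws 'I_n -> T}) x i :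
  add_last p x (lift ord_max i) = p i.
Proof. by rewrite /add_last liftK. Qed.

Lemma add_last_max n (p : {ptws 'I_n -> T}) x : add_last p x ord_max = x.
Proof. by rewrite /add_last unlift_none. Qed.

Lemma add_lastK n (p : {ptws 'I_n -> T}) x : drop_last (add_last p x) = p.
Proof.
by apply/funext => i; rewrite /drop_last widen_ord_lift add_last_lift.
Qed.

Lemma drop_lastK n (q : {ptws 'I_n.+1 -> T}) :
  add_last (drop_last q) (q ord_max) = q.
Proof.
apply/funext => i; rewrite /add_last; case: unliftP => [j ->|->] //.
by rewrite /drop_last widen_ord_lift.
Qed.

Lemma cvg_drop_last (S : Type) (F : set_system S) {FF : Filter F} (n : nat)
    (f : S -> {ptws 'I_n.+1 -> T}) (q : {ptws 'I_n.+1 -> T}) :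
  f x @[x --> F] --> q -> drop_last (f x) @[x --> F] --> drop_last q.
Proof.
by move=> fq; apply: cvg_ptws => i; exact: (@cvg_ptws_coord S F FF _ _ f).
Qed.

Lemma cvg_add_last (S : Type) (F : set_system S) {FF : Filter F} (n : nat)
    (f : S -> {ptws 'I_n -> T}) (p : {ptws 'I_n -> T}) (g : S -> T) (a : T) :
  f x @[x --> F] --> p -> g x @[x --> F] --> a ->
  add_last (f x) (g x) @[x --> F] --> add_last p a.
Proof.
move=> fp ga; apply: cvg_ptws => i; rewrite /add_last.
by case: (unlift _ i) => [j|//]; exact: (@cvg_ptws_coord S F FF _ _ f).
Qed.

(** The enumeration of index sets is increasing, so the last index, when
    present, comes last: this is how the family indexed by [J] splits into a
    family of points of [drop_last q] and, possibly, the added point. *)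
Lemma enum_setSr n (J : {set 'I_n.+1}) (I := (lift ord_max @^-1: J)%SET) :
  enum J = if ord_max \in J
           then rcons [seq lift ord_max i | i <- enum I] ord_max
           else [seq lift ord_max i | i <- enum I].
Proof.
rewrite {1}/enum_mem -enumT /= enum_ordSr filter_rcons /= filter_map.
suff -> : [seq widen_ord (leqnSn n) i | i <-
    [seq x <- enum 'I_n | preim (widen_ord (leqnSn n)) (mem J) x]] =
    [seq lift ord_max i | i <- enum I] by [].
rewrite {2}/enum_mem -enumT (eq_map (@widen_ord_lift n)); congr map.
by apply: eq_filter => i /=; rewrite inE widen_ord_lift.
Qed.

(** A [k]-element set of indices of [n.+1] points either avoids the last
    index, or consists of it and of [k.-1] other indices. The second case
    says that the last point lies outside [Q]. *)
Lemma W_addP (k n : nat) (M : set T) (q : {ptws 'I_n.+1 -> T}) : (0 < k)%N ->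
  W indep k n.+1 M q <->
  W indep k n M (drop_last q) /\
  (M `\` Q indep k.-1 M (drop_last q)) (q ord_max).
Proof.
have dropE (s : seq 'I_n) :
    [seq q i | i <- [seq lift ord_max i | i <- s]] =
    [seq drop_last q i | i <- s].
  rewrite -map_comp; apply: eq_map => i /=.
  by rewrite /drop_last widen_ord_lift.
move=> k0; split=> [Wq|[[Mp Ip] [Mx Qx]]].
  split; first exact: drop_last_W.
  case: Wq => Mq Iq; split=> // -[I /= cI [_ /negP]]; apply.
  pose J := (ord_max |: lift ord_max @: I)%SET.
  have mJ : ord_max \notin (lift ord_max @: I)%SET.
    by apply/imsetP => -[i _ /eqP]; rewrite (negbTE (neq_lift _ _)).
  have IJ : (lift ord_max @^-1: J)%SET = I.
    apply/setP => i; rewrite !inE eq_sym (negbTE (neq_lift _ _)) /=.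
    by rewrite mem_imset //; exact: lift_inj.
  have := Iq J; rewrite cardsU1 mJ card_imset ?cI; last exact: lift_inj.
  rewrite add1n prednK // => /(_ erefl).
  rewrite enum_setSr IJ setU11 map_rcons dropE.
  by rewrite (perm_indep (permEl (perm_rcons _ _))).
split=> [i|J cJ].
  case: (unliftP ord_max i) => [j ->|-> //].
  by have := Mp j; rewrite /drop_last widen_ord_lift.
have := cardE J; rewrite cJ enum_setSr; case: ifP => _.
  rewrite size_rcons size_map -cardE map_rcons dropE => kI.
  rewrite (perm_indep (permEl (perm_rcons _ _))).
  apply/negPn/negP => indepN; apply: Qx.
  by exists (lift ord_max @^-1: J)%SET => //=; rewrite kI.
by rewrite size_map -cardE dropE => kI; exact: Ip.
Qed.

Section Charts.
Variables (k n : nat) (M : set T) (b : 'I_n -> T).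
Hypothesis k_gt0 : (0 < k)%N.

Let fib (p : 'I_n -> T) := M `\` Q indep k.-1 M p.

Let Wn := W indep k n M.

(** [alpha p] stands for a linear or projective transformation that carries
    the standard configuration [b] to [p], and [beta p] for its inverse. Both
    are total functions, constrained only at the configurations in [U], so
    that they can be given by formulas with a limited domain of validity,
    such as the inversion of a matrix. *)
Record frame_chart (U : set {ptws 'I_n -> T})
    (alpha beta : {ptws 'I_n -> T} -> T -> T) : Prop := FrameChart {
  chart_open : open U;
  chart_indep p s : (U `&` Wn) p -> indep [seq alpha p x | x <- s] = indep s;
  chart_frame p i : (U `&` Wn) p -> alpha p (b i) = p i;
  chart_stable p x : (U `&` Wn) p -> M x -> M (alpha p x);
  chart_stableV p x : (U `&` Wn) p -> M x -> M (beta p x);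
  chart_K p x : (U `&` Wn) p -> M x -> beta p (alpha p x) = x;
  chart_VK p x : (U `&` Wn) p -> M x -> alpha p (beta p x) = x;
  chart_cvg p x : (U `&` Wn) p -> fib b x ->
    alpha q.1 q.2 @[q --> (p, x)] --> alpha p x;
  chart_cvgV p x : (U `&` Wn) p -> fib p x ->
    beta q.1 q.2 @[q --> (p, x)] --> beta p x }.

(** Since [alpha p] preserves independence and carries [b] to [p], the point
    [x] is dependent on some points of [b] exactly when [alpha p x] is
    dependent on the points of [p] with the same indices. *)
Lemma chart_fib U alpha beta p x : frame_chart U alpha beta ->
  (U `&` Wn) p -> M x ->
  fib p (alpha p x) <-> fib b x.
Proof.
move=> ch Up Mx; have Max := chart_stable ch Up Mx.
have QE I : indep (alpha p x :: [seq p i | i <- enum I]) =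
            indep (x :: [seq b i | i <- enum I]).
  rewrite -[RHS](chart_indep ch _ Up) /= -map_comp; congr (indep (_ :: _)).
  by apply: eq_map => i /=; rewrite (chart_frame ch).
by split=> -[_ Qx]; split=> // -[I cI [_ NI]]; apply: Qx; exists I => //;
  split=> //; move: NI; rewrite QE.
Qed.

(** The trivialization over [U] sends a configuration [q] over [p] to [p] and
    [beta p q_n], where [q_n] is the last point of [q]; its inverse appends
    [alpha p x] to [p]. *)
Lemma fiber_bundle_of_charts :
  (forall p, Wn p -> exists x, fib p x) ->
  (forall p, W indep k n M p -> exists U alpha beta,
     U p /\ frame_chart U alpha beta) ->
  fiber_bundle (fib b) (W_proj indep k n M).
Proof.
move=> fib0 charts.
have fibV U alpha beta p x : frame_chart U alpha beta ->
      (U `&` Wn) p -> fib p x -> fib b (beta p x).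
  move=> ch Up /[dup] -[Mx _] px.
  apply/(chart_fib ch Up (chart_stableV ch Up Mx)).
  by rewrite (chart_VK ch).
have WP (q : {ptws 'I_n.+1 -> T}) := W_addP M q k_gt0.
have WA p x : W indep k n M p -> fib p x -> W indep k n.+1 M (add_last p x).
  by move=> Wp px; apply/WP; rewrite add_lastK add_last_max.
split.
- move=> e; apply: (@cvg_set_type _ (nbhs e) _).
  by apply: (@cvg_drop_last _ (nbhs e) _); apply: cvg_val; exact: cvg_id.
- move=> p; have Wp := set_mem (valP p); have [x px] := fib0 _ Wp.
  by exists (set_elt (WA _ _ Wp px)); apply: val_inj; exact: add_lastK.
move=> p0; have [U [alpha [beta [Up0 ch]]]] := charts _ (set_mem (valP p0)).
pose V : set (W indep k n M) := \val @^-1` U.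
exists V; split=> //.
  apply: open_comp; last exact: (chart_open ch).
  by move=> x _; exact: initial_continuous.
have Ue (e : W_proj indep k n M @^-1` V) :
    (U `&` Wn) (drop_last (\val (\val e))).
  split; first exact: (set_mem (valP e)).
  exact: (set_mem (valP (W_proj indep k n M (\val e)))).
have Fe (e : W_proj indep k n M @^-1` V) :
    fib (drop_last (\val (\val e))) (\val (\val e) ord_max).
  by have /WP[] := set_mem (valP (\val e)).
pose h (e : W_proj indep k n M @^-1` V) : (V * fib b)%type :=
  (@set_elt _ V (W_proj indep k n M (\val e)) (set_mem (valP e)),
   set_elt (fibV _ _ _ _ _ ch (Ue e) (Fe e))).
have Uu (u : (V * fib b)%type) : (U `&` Wn) (\val (\val u.1)).
  by split; [exact: (set_mem (valP u.1))|exact: (set_mem (valP (\val u.1)))].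
have Fg (u : (V * fib b)%type) :
    fib (\val (\val u.1)) (alpha (\val (\val u.1)) (\val u.2)).
  have ux := set_mem (valP u.2).
  by apply/(chart_fib ch (Uu u) (proj1 ux)).
pose g' (u : (V * fib b)%type) : W indep k n.+1 M :=
  set_elt (WA _ _ (set_mem (valP (\val u.1))) (Fg u)).
have g'P u : W_proj indep k n M (g' u) = \val u.1.
  by apply: val_inj; exact: add_lastK.
have Vg u : (W_proj indep k n M @^-1` V) (g' u).
  by rewrite /preimage /= g'P; exact: (set_mem (valP u.1)).
pose g u : W_proj indep k n M @^-1` V := set_elt (Vg u).
exists h; split=> //; split; last exists g; last split.
- move=> e.
  have FFe : Filter (nbhs e) := nbhs_filter e.
  have ce : \val (\val x) @[x --> nbhs e] --> \val (\val e).
    by do 2!apply: cvg_val; exact: cvg_id.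
  have cd := @cvg_drop_last _ (nbhs e) FFe _ _ _ ce.
  have cm := @cvg_ptws_coord _ (nbhs e) FFe _ _ _ _ ord_max ce.
  apply: (@cvg_pair _ _ _ (nbhs e) (nbhs (h e).1) (nbhs (h e).2)).
  + by do 2!apply: (@cvg_set_type _ (nbhs e) _); exact: cd.
  + apply: (@cvg_set_type _ (nbhs e) _).
    exact: (continuous2_cvg FFe (chart_cvgV ch (Ue e) (Fe e)) cd
      cm).
- move=> u; do 2!apply: (@cvg_set_type _ (nbhs u) _).
  have FFu : Filter (nbhs u) := nbhs_filter u.
  have c1 : \val (\val v.1) @[v --> nbhs u] --> \val (\val u.1).
    by do 2!apply: cvg_val; exact: cvg_fst.
  have c2 : \val v.2 @[v --> nbhs u] --> \val u.2.
    by apply: cvg_val; exact: cvg_snd.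
  apply: (@cvg_add_last _ (nbhs u)) => //.
  exact: (continuous2_cvg _
    (chart_cvg ch (Uu u) (set_mem (valP u.2))) c1 c2).
- move=> e; apply: val_inj; apply: val_inj => /=.
  rewrite (chart_VK ch); [exact: drop_lastK|exact: Ue|by case: (Fe e)].
- move=> u; rewrite [RHS]surjective_pairing; congr (_, _).
    by apply: val_inj; exact: g'P.
  apply: val_inj => /=; rewrite add_lastK add_last_max (chart_K ch) //.
    exact: Uu.
  by case: (set_mem (valP u.2)).
Qed.

End Charts.
End Configurations.

(** * Free families and invertible matrices *)

Section Free.
Variables (K : fieldType) (vT : vectType K).

(** Freeness depends only on the lines spanned by the vectors. This makes it
    insensitive to normalization and to the choice of representatives of
    points of a projective space. *)
Lemma eq_free_lines (I : Type) (f g : I -> vT) (s : seq I) :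
  (forall i, <[f i]>%VS = <[g i]>%VS) ->
  free [seq f i | i <- s] = free [seq g i | i <- s].
Proof.
move=> fg; elim: s => //= i s IHs; rewrite !free_cons IHs !memvE fg.
congr (~~ (_ <= _)%VS && _).
by elim: s {IHs} => //= j s IHs; rewrite !span_cons IHs fg.
Qed.

Lemma free_seqP (I : eqType) (f : I -> vT) (s : seq I) : uniq s ->
  free [seq f i | i <- s] <->
  forall c : I -> K, \sum_(i <- s) c i *: f i = 0 -> {in s, forall i, c i = 0}.
Proof.
move=> us; case: s us => [|i0 s us]; first by split=> // _; rewrite /= nil_free.
set t := i0 :: s; have sumE (c : I -> K) : \sum_(i <- t) c i *: f i =
    \sum_(i < size (map f t)) c (nth i0 t i) *: (map f t)`_i.
  rewrite (big_nth i0) big_mkord size_map; apply: eq_bigr => i _.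
  by rewrite (nth_map i0).
split=> [/(@freeP _ _ _ (in_tuple _)) ft c|ft].
  rewrite sumE => /ft ct i it.
  have ilt : (index i t < size (map f t))%N by rewrite size_map index_mem.
  by have := ct (Ordinal ilt); rewrite /= nth_index.
apply/(@freeP _ _ _ (in_tuple (map f t))) => k sk0 i.
pose c x := if insub (index x t) is Some j then k j else 0.
have cE (j : 'I_(size (map f t))) : c (nth i0 t j) = k j.
  by rewrite /c index_uniq ?valK // -(size_map f).
rewrite -cE; apply: ft.
  by rewrite sumE -[RHS]sk0; apply: eq_bigr => j _; rewrite cE.
by apply: mem_nth; rewrite -(size_map f).
Qed.

Lemma free_consP (I : eqType) (x : vT) (f : I -> vT) (s : seq I) : uniq s ->
  free (x :: [seq f i | i <- s]) <->
  forall (a : K) (c : I -> K), a *: x + \sum_(i <- s) c i *: f i = 0 ->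
    a = 0 /\ {in s, forall i, c i = 0}.
Proof.
move=> us; pose g o := if o is Some i then f i else x.
have -> : x :: [seq f i | i <- s] = [seq g o | o <- None :: map Some s].
  by rewrite /= -map_comp.
have us' : uniq (None :: map Some s).
  rewrite /= map_inj_uniq ?us ?andbT; last by move=> ? ? [].
  by apply/mapP => -[].
split=> [/(free_seqP g us') fs a c|fs].
  move=> ac0; pose c' o := if o is Some i then c i else a.
  have /fs : \sum_(o <- None :: map Some s) c' o *: g o = 0.
    by rewrite big_cons big_map.
  move=> c0; split; first by apply: (c0 None); rewrite inE.
  by move=> i si; apply: (c0 (Some i)); rewrite inE /= map_f.
apply/(free_seqP g us') => c; rewrite big_cons big_map => /fs[cN cs] o.
by rewrite inE => /predU1P[->//|/mapP[i si ->]]; exact: cs.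
Qed.

Lemma free_enumP (n : nat) (f : 'I_n -> vT) (I : {set 'I_n}) :
  free [seq f i | i <- enum I] <->
  forall c : 'I_n -> K, \sum_(i in I) c i *: f i = 0 ->
    {in I, forall i, c i = 0}.
Proof.
split=> [/(free_seqP f (enum_uniq _)) fI c c0 i iI|fI].
  by apply: fI; rewrite ?mem_enum // big_enum.
apply/(free_seqP f (enum_uniq _)) => c; rewrite big_enum => /fI cI i.
by rewrite mem_enum; exact: cI.
Qed.

End Free.

Section FreeRows.
Variables (K : fieldType) (n : nat).

Lemma free_mulmx (A : 'M[K]_n) (s : seq 'rV[K]_n) : A \in unitmx ->
  free [seq x *m A | x <- s] = free s.
Proof.
suff impl (B : 'M[K]_n) (t : seq 'rV[K]_n) : B \in unitmx ->
    free t -> free [seq x *m B | x <- t].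
  move=> uA; apply/idP/idP; last exact: impl.
  have uV : invmx A \in unitmx by rewrite unitmx_inv.
  move/(impl _ _ uV); rewrite -map_comp (@eq_map _ _ _ id) ?map_id // => x /=.
  by rewrite mulmxK.
move=> uB /(@freeP _ _ _ (in_tuple t)) ft.
rewrite -[t]/(val (in_tuple t)) -[map _ _]/(val [tuple of map _ _]).
apply/freeP => c c0; apply: ft.
apply: (can_inj (mulmxK uB)); rewrite mul0mx -[RHS]c0 mulmx_suml.
by apply: eq_bigr => i _; rewrite -scalemxAl (nth_map 0).
Qed.

Lemma free_unitmx (s : seq 'rV[K]_n) (A : 'M[K]_n) : free s -> size s = n ->
  (forall i : 'I_n, row i A = s`_i) -> A \in unitmx.
Proof.
move=> fs /eqP sn As; rewrite -row_free_unit; apply: inj_row_free => u.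
rewrite mulmx_sum_row => uA0; apply/rowP => i; rewrite mxE.
move: (@freeP _ _ _ (Tuple sn) fs (u 0)); apply.
by rewrite -[RHS]uA0; apply: eq_bigr => j _; rewrite As.
Qed.

(** The rows of [C] of index at least [k] complete [p] to [n] vectors.
    Keeping [C] fixed while [p] varies makes the completion continuous in
    [p]. *)
Definition complete_mx (k : nat) (p : 'I_k -> 'rV[K]_n) (C : 'M[K]_n) :
    'M[K]_n :=
  \matrix_i (if insub (val i) is Some j then p j else row i C).

Lemma row_complete_mx (k : nat) (p : 'I_k -> 'rV[K]_n) C (i : 'I_n) (j : 'I_k) :
  val i = val j -> row i (complete_mx p C) = p j.
Proof. by move=> ij; rewrite rowK ij valK. Qed.

(** The rows of index at least [k] are taken from a basis of a complement of
    the span of [p]. *)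
Lemma exists_complete_mx (k : nat) (p : 'I_k -> 'rV[K]_n) :
  free [seq p i | i <- enum 'I_k] -> exists C, complete_mx p C \in unitmx.
Proof.
set s := map _ _ => fs; pose t := s ++ vbasis ((span s)^C)%VS.
have sk : size s = k by rewrite size_map size_enum_ord.
have ft : free t.
  rewrite cat_free fs (basis_free (vbasisP _)) /=.
  by rewrite (span_basis (vbasisP _)); apply/directv_addP; exact: capv_compl.
have st : size t = n.
  have dn : \dim {:'rV[K]_n} = n by rewrite dimvf dim_matrix mul1r.
  rewrite size_cat (size_tuple (vbasis _)) dimv_compl dn -(eqP fs).
  by rewrite subnKC // -[leqRHS]dn dimvS ?subvf.
exists (\matrix_i t`_i); apply: (free_unitmx ft st) => i.
rewrite rowK; case: insubP => [j _ ij|]; last by rewrite rowK.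
rewrite nth_cat sk -ij ltn_ord (nth_map j) ?size_enum_ord ?ltn_ord //.
by rewrite nth_ord_enum.
Qed.

End FreeRows.

(** * Frames of vectors *)

Section VectorFrames.
Variables (R : realType) (m : nat).
Local Notation V := 'rV[R]_m.+1.

Lemma cvg_complete_mx (S : Type) (F : set_system S) {FF : Filter F} (k : nat)
    (f : S -> {ptws 'I_k -> V}) (p : {ptws 'I_k -> V}) (C : 'M[R]_m.+1) :
  f x @[x --> F] --> p -> complete_mx (f x) C @[x --> F] --> complete_mx p C.
Proof.
move=> fp; apply: cvg_mx => i j; rewrite mxE; under eq_fun do rewrite mxE.
case: insub => [l|]; last exact: cvg_cst.
by apply: cvg_coord; exact: (@cvg_ptws_coord _ F FF _ _ f).
Qed.

Lemma cvg_sum_ptws (S : Type) (F : set_system S) {FF : Filter F} (k : nat)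
    (f : S -> {ptws 'I_k -> V}) (p : {ptws 'I_k -> V}) :
  f x @[x --> F] --> p -> \sum_i f x i @[x --> F] --> \sum_i p i.
Proof.
move=> fp; apply: cvg_mx => i j; rewrite summxE.
under eq_fun do rewrite summxE.
apply: cvg_sumr => l _; apply: cvg_coord.
exact: (@cvg_ptws_coord _ F FF _ _ f).
Qed.

Lemma vfree_perm (s t : seq V) : perm_eq s t -> vfree s = vfree t.
Proof. exact: perm_free. Qed.

Variable M : set V.

Lemma W_free (k : nat) (p : {ptws 'I_k -> V}) :
  W vfree k k M p -> free [seq p i | i <- enum 'I_k].
Proof.
case=> _ /(_ [set: 'I_k]%SET).
by rewrite enum_setT -enumT cardsT card_ord; exact.
Qed.

Lemma fiber_neq0 (k : nat) (p : 'I_k -> V) (x : V) : (0 < k)%N ->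
  (M `\` Q vfree k.-1 M p) x -> x != 0.
Proof.
move=> k0 [Mx Qx]; apply/negP => /eqP x0; apply: Qx.
exists [set~ Ordinal k0]%SET => /=; first by rewrite cardsC1 card_ord.
by split=> //; apply/negP => /free_not0/(_ (mem_head _ _)); rewrite x0 eqxx.
Qed.

(** Some index [j] is missing from [I]. In a dependence relation, the
    coefficient of [p j] is the coefficient [a] of the sum, so [a] vanishes,
    and what remains is a relation between the [p i]. *)
Lemma sum_free (k : nat) (p : 'I_k -> V) (I : {set 'I_k}) :
  free [seq p i | i <- enum 'I_k] -> #|I| != k ->
  free (\sum_i p i :: [seq p i | i <- enum I]).
Proof.
move=> fp cI; apply/free_consP; first exact: enum_uniq.
move=> a c; rewrite big_enum /= scaler_sumr (big_mkcond (mem I)) -big_split /=.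
pose d i := a + (if i \in I then c i else 0).
rewrite (eq_bigr (fun i => d i *: p i)) => [|i _]; last first.
  by rewrite /d scalerDl; case: ifP => //; rewrite scale0r.
rewrite -big_enum; move/(free_seqP p (enum_uniq _)): fp => /[apply] d0.
have {}d0 i : d i = 0 by apply: d0; rewrite mem_enum.
have [j jI] : exists j, j \notin I.
  apply/existsP; apply: contraR cI; rewrite negb_exists => /forallP /= IT.
  rewrite (_ : I = [set: 'I_k]%SET) ?cardsT ?card_ord //.
  by apply/setP => i; rewrite inE; apply/negPn/IT.
have a0 : a = 0 by have := d0 j; rewrite /d (negbTE jI) addr0.
split=> // i; rewrite mem_enum => iI.
by have := d0 i; rewrite /d iI a0 add0r.
Qed.

(** [r] is a retraction onto [M] along lines. The identity when [M] is the
    whole space, and the normalization of vectors when [M] is the sphere,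
    have these properties; the constructions below are linear maps followed
    by [r]. *)
Variable r : V -> V.
Hypothesis r_line : forall x, <[r x]>%VS = <[x]>%VS.
Hypothesis r_id : forall x, M x -> r x = x.
Hypothesis r_stable : forall x, x != 0 \/ M 0 -> M (r x).
Hypothesis r_mulmx : forall x (A : 'M[R]_m.+1), r (r x *m A) = r (x *m A).
Hypothesis r_continuous : forall x, x != 0 -> {for x, continuous r}.

Lemma mulmx_unit_neq0 (x : V) (A : 'M[R]_m.+1) : A \in unitmx ->
  x != 0 -> x *m A != 0.
Proof.
move=> uA; apply: contraNneq => xA0.
by rewrite -(mulmxK uA x) xA0 mul0mx.
Qed.

Lemma retract_stable (x : V) (A : 'M[R]_m.+1) : A \in unitmx ->
  M x -> M (r (x *m A)).
Proof.
move=> uA Mx; apply: r_stable; have [x0|x0] := eqVneq x 0.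
  by right; rewrite -x0.
by left; exact: mulmx_unit_neq0.
Qed.

Lemma retractK (x : V) (A B : 'M[R]_m.+1) : A *m B = 1%:M ->
  M x -> r (r (x *m A) *m B) = x.
Proof. by move=> AB Mx; rewrite r_mulmx -mulmxA AB mulmx1 r_id. Qed.

Variable k : nat.
Hypotheses (k_gt0 : (0 < k)%N) (km : (k <= m.+1)%N).

(** The completion of [p0] by [C] is invertible, and remains so for nearby
    [p]; this matrix carries the standard basis vectors to the vectors of
    [p]. *)
Lemma vector_chart (p0 : {ptws 'I_k -> V}) : W vfree k k M p0 ->
  exists U alpha beta, U p0 /\ frame_chart vfree k M (b_ R m k) U alpha beta.
Proof.
move=> Wp0; have [C uC] := exists_complete_mx (W_free Wp0).
exists [set p | complete_mx p C \in unitmx].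
exists (fun p x => r (x *m complete_mx p C)).
exists (fun p y => r (y *m invmx (complete_mx p C))).
split=> //; split=> /=.
- rewrite openE => p Up; apply: (@near_unitmx _ (nbhs p) _ _ _ _ _ Up).
  by apply: cvg_complete_mx; exact: cvg_id.
- move=> p s [uA _]; rewrite /vfree -(free_mulmx s uA).
  by apply: eq_free_lines => x; exact: r_line.
- move=> p i [_ [Mp _]]; rewrite /b_ /e_ -rowE.
  rewrite (@row_complete_mx _ _ _ p C (inord i) i) ?r_id //=.
  by rewrite inordK // (leq_trans (ltn_ord i) km).
- by move=> p x [uA _]; exact: retract_stable.
- by move=> p x [uA _]; apply: retract_stable; rewrite unitmx_inv.
- by move=> p x [uA _]; apply: retractK; exact: mulmxV.
- by move=> p x [uA _]; apply: retractK; exact: mulVmx.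
- move=> p x [uA _] /(fiber_neq0 k_gt0) x0.
  apply: (@continuous_cvg _ _ _ (nbhs (p, x))).
    by apply: r_continuous; exact: mulmx_unit_neq0.
  apply: (@cvg_mulmx _ (nbhs (p, x))); first exact: cvg_snd.
  by apply: cvg_complete_mx; exact: cvg_fst.
- move=> p x [uA _] /(fiber_neq0 k_gt0) x0.
  apply: (@continuous_cvg _ _ _ (nbhs (p, x))).
    by apply: r_continuous; apply: mulmx_unit_neq0 => //; rewrite unitmx_inv.
  apply: (@cvg_mulmx _ (nbhs (p, x))); first exact: cvg_snd.
  apply: cvg_invmx => //.
  by apply: cvg_complete_mx; exact: cvg_fst.
Qed.

Lemma sum_neq0 (p : {ptws 'I_k -> V}) : W vfree k k M p -> \sum_i p i != 0.
Proof.
move=> /W_free fp; pose I := [set~ Ordinal k_gt0]%SET.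
apply: (free_not0 (sum_free (I := I) fp _)); last exact: mem_head.
by rewrite cardsC1 card_ord neq_ltn ltn_predL k_gt0.
Qed.

Lemma sum_W (p : {ptws 'I_k -> V}) : W vfree k k M p ->
  W vfree k k.+1 M (add_last p (r (\sum_i p i))).
Proof.
move=> Wp; apply/(W_addP vfree_perm) => //; rewrite add_lastK add_last_max.
split=> //; split; first by apply: r_stable; left; exact: sum_neq0.
case=> I /= cI [_]; rewrite /vfree free_cons memvE r_line -memvE -free_cons.
by rewrite sum_free ?W_free // cI neq_ltn ltn_predL k_gt0.
Qed.

Lemma sum_cross_section :
  exists s : W vfree k k M -> W vfree k k.+1 M,
    cross_section (W_proj vfree k k M) s.
Proof.
exists (fun p => set_elt (sum_W (set_mem (valP p)))); split; last first.
  by move=> p; apply: val_inj; exact: add_lastK.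
move=> p; apply: (@cvg_set_type _ (nbhs p) _) => /=.
have cp : \val q @[q --> nbhs p] --> \val p by apply: cvg_val; exact: cvg_id.
apply: (@cvg_add_last _ _ (nbhs p)) => //.
apply: (@continuous_cvg _ _ _ (nbhs p)).
  apply: r_continuous.
  exact: (sum_neq0 (set_mem (valP p))).
exact: (@cvg_sum_ptws _ (nbhs p)).
Qed.

Lemma vector_fiber_bundle :
  fiber_bundle (M `\` Q vfree k.-1 M (b_ R m k)) (W_proj vfree k k M).
Proof.
apply: (fiber_bundle_of_charts vfree_perm) => //; last exact: vector_chart.
move=> p /sum_W /(W_addP vfree_perm) => /(_ k_gt0).
rewrite add_lastK add_last_max => -[_ ?].
by exists (r (\sum_i p i)).
Qed.

End VectorFrames.

(** * The whole space and the sphere *)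

Section Sphere.
Variables (R : realType) (m : nat).
Local Notation V := 'rV[R]_m.+1.
Implicit Types x : V.

Definition sqnorm x : R := \sum_i x 0 i ^+ 2.

Definition normalize x : V := (Num.sqrt (sqnorm x))^-1 *: x.

Lemma sqnormZ (a : R) x : sqnorm (a *: x) = a ^+ 2 * sqnorm x.
Proof.
by rewrite /sqnorm mulr_sumr; apply: eq_bigr => i _; rewrite mxE exprMn.
Qed.

Lemma sqnorm_gt0 x : x != 0 -> 0 < sqnorm x.
Proof.
move=> x0; rewrite lt_def sumr_ge0 ?andbT => [|i _]; last exact: sqr_ge0.
apply: contra x0 => /eqP/psumr_eq0P H; apply/eqP/rowP => i; rewrite mxE.
by apply/eqP; rewrite -sqrf_eq0 H // => j _; exact: sqr_ge0.
Qed.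

Lemma sqnorm_continuous : continuous sqnorm.
Proof.
move=> x; apply: (@cvg_sumr _ (nbhs x)) => i _.
under eq_fun do rewrite expr2.
by rewrite expr2; apply: cvgM; apply: coord_continuous.
Qed.

Lemma line_scale (a : R) x : a != 0 -> <[a *: x]>%VS = <[x]>%VS.
Proof.
move=> a0; apply/eqP; rewrite eqEsubv -!memvE memvZ ?memv_line //=.
by rewrite -[X in X \in _](scalerK a0) memvZ ?memv_line.
Qed.

Lemma normalize_line x : <[normalize x]>%VS = <[x]>%VS.
Proof.
have [->|x0] := eqVneq x 0; first by rewrite /normalize scaler0.
by rewrite line_scale // invr_eq0 lt0r_neq0 // sqrtr_gt0 sqnorm_gt0.
Qed.

Lemma normalize_id x : sphere R m x -> normalize x = x.
Proof.
by rewrite /sphere /normalize /sqnorm /= => ->; rewrite sqrtr1 invr1 scale1r.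
Qed.

Lemma normalize_sphere x : x != 0 -> sphere R m (normalize x).
Proof.
move=> /sqnorm_gt0 x0.
have -> : sphere R m (normalize x) = (sqnorm (normalize x) = 1) by [].
by rewrite sqnormZ exprVn sqr_sqrtr ?ltW // mulVf // gt_eqF.
Qed.

Lemma normalizeZ (a : R) x : 0 < a -> normalize (a *: x) = normalize x.
Proof.
move=> a0; rewrite /normalize sqnormZ sqrtrM ?sqr_ge0 // sqrtr_sqr gtr0_norm //.
by rewrite scalerA invfM mulrAC mulVf ?mul1r // gt_eqF.
Qed.

Lemma normalize_mulmx x (A : 'M[R]_m.+1) :
  normalize (normalize x *m A) = normalize (x *m A).
Proof.
have [->|x0] := eqVneq x 0; first by rewrite /normalize scaler0.
by rewrite -scalemxAl normalizeZ // invr_gt0 sqrtr_gt0 sqnorm_gt0.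
Qed.

Lemma normalize_continuous x : x != 0 -> {for x, continuous normalize}.
Proof.
move=> x0; apply: (@cvg_scalemx _ (nbhs x)); last exact: cvg_id.
apply: cvgV; first by rewrite lt0r_neq0 // sqrtr_gt0 sqnorm_gt0.
apply: (@continuous_cvg _ _ _ (nbhs x)); first exact: sqrt_continuous.
exact: sqnorm_continuous.
Qed.

Lemma vector_or_sphere_bundle (M : set V) (k : nat) :
  M = setT \/ M = sphere R m -> (0 < k)%N -> (k <= m.+1)%N ->
  fiber_bundle (M `\` Q vfree k.-1 M (b_ R m k)) (W_proj vfree k k M) /\
  exists s : W vfree k k M -> W vfree k k.+1 M,
    cross_section (W_proj vfree k k M) s.
Proof.
move=> HM k0 km.
have [r [rl ri rs rm rc]] : exists r : V -> V,
    [/\ forall x, <[r x]>%VS = <[x]>%VS,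
        forall x, M x -> r x = x,
        forall x, x != 0 \/ M 0 -> M (r x),
        forall x (A : 'M[R]_m.+1), r (r x *m A) = r (x *m A) &
        forall x, x != 0 -> {for x, continuous r}].
  case: HM => ->; first by exists id; split=> // x _; exact: cvg_id.
  exists normalize; split.
  - exact: normalize_line.
  - exact: normalize_id.
  - move=> x [|]; first exact: normalize_sphere.
    rewrite /sphere /= => /eqP; rewrite big1 ?(eq_sym 0) ?oner_eq0 // => i _.
    by rewrite mxE expr0n.
  - exact: normalize_mulmx.
  - exact: normalize_continuous.
split; first exact: (vector_fiber_bundle rl).
exact: (sum_cross_section rl).
Qed.

End Sphere.

(** * Frames of a projective space *)

Section Frames.
Variables (K : fieldType) (n : nat) (v : 'I_n.+1 -> 'rV[K]_n).
Hypothesis v_free : forall I : {set 'I_n.+1}, #|I| = n ->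
  free [seq v i | i <- enum I].

Definition base_mx : 'M[K]_n := \matrix_i v (lift ord_max i).
(** The coordinates of the last vector in the basis formed by the others. *)
Definition frame_coord : 'rV[K]_n := v ord_max *m invmx base_mx.
(** Scaling each basis vector by the corresponding coordinate leaves its line
    unchanged, and makes the sum of the rows equal to the last vector: up to
    a scalar, this is the only matrix that carries the standard projective
    frame to the lines spanned by [v]. *)
Definition frame_mx : 'M[K]_n := diag_mx frame_coord *m base_mx.

Lemma base_mx_unit : base_mx \in unitmx.
Proof.
pose s := [seq v (lift ord_max i) | i <- enum 'I_n].
have fs : free s.
  have := v_free (I := [set~ ord_max]%SET).
  rewrite cardsC1 card_ord enum_setSr !inE eqxx -map_comp => /(_ erefl).
  rewrite (_ : enum _ = enum 'I_n) //; apply: eq_enum => i.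
  by rewrite !inE eq_sym neq_lift.
apply: (free_unitmx fs); first by rewrite size_map size_enum_ord.
by move=> i; rewrite rowK (nth_map i) ?size_enum_ord // nth_ord_enum.
Qed.

Lemma frame_coordE :
  \sum_i frame_coord 0 i *: v (lift ord_max i) = v ord_max.
Proof.
rewrite -[RHS](mulmxKV base_mx_unit) -/frame_coord mulmx_sum_row.
by apply: eq_bigr => i _; rewrite rowK.
Qed.

(** If the [i]th coordinate were zero, then the last vector would be a
    combination of the [n.-1] basis vectors other than the [i]th one, and
    those [n] vectors would not be free. *)
Lemma frame_coord_neq0 i : frame_coord 0 i != 0.
Proof.
apply/negP => /eqP ci0; pose I := [set~ lift ord_max i]%SET.
have cI : #|I| = n by rewrite cardsC1 card_ord.
pose c j := if unlift ord_max j is Some l then frame_coord 0 l else -1.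
have /free_enumP/(_ c) := v_free cI.
have cmax : c ord_max = -1 by rewrite /c unlift_none.
have clift l : c (lift ord_max l) = frame_coord 0 l by rewrite /c liftK.
move=> c0; have : c ord_max = 0.
  apply: c0; last by rewrite !inE neq_lift.
  have sum0 : \sum_j c j *: v j = 0.
    rewrite big_ord_recr /= cmax scaleN1r -frame_coordE; apply/eqP.
    rewrite subr_eq0; apply/eqP/eq_bigr => l _.
    by rewrite widen_ord_lift clift.
  rewrite -[RHS]sum0 [RHS](bigD1 (lift ord_max i)) //= clift ci0 scale0r add0r.
  by apply: eq_bigl => j; rewrite !inE.
by rewrite cmax => /eqP; rewrite oppr_eq0 oner_eq0.
Qed.

Lemma frame_mx_unit : frame_mx \in unitmx.
Proof.
rewrite unitmx_mul base_mx_unit andbT unitmxE det_diag unitfE.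
by apply/prodf_neq0 => i _; exact: frame_coord_neq0.
Qed.

Lemma frame_mx_base i :
  delta_mx 0 i *m frame_mx = frame_coord 0 i *: v (lift ord_max i).
Proof. by rewrite -rowE row_mul row_diag_mx -scalemxAl -rowE rowK. Qed.

Lemma frame_mx_sum : (\sum_i delta_mx 0 i) *m frame_mx = v ord_max.
Proof.
rewrite mulmx_suml -frame_coordE; apply: eq_bigr => i _.
exact: frame_mx_base.
Qed.

End Frames.

Section StandardFrame.
Variables (R : numFieldType) (m : nat).
Local Notation V := 'rV[R]_m.+1.

Definition std_vec (i : 'I_m.+2) : V :=
  if unlift ord_max i is Some j then delta_mx 0 j else \sum_j delta_mx 0 j.

Lemma std_vec_lift j : std_vec (lift ord_max j) = delta_mx 0 j.
Proof. by rewrite /std_vec liftK. Qed.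

Lemma std_vec_max : std_vec ord_max = \sum_j delta_mx 0 j.
Proof. by rewrite /std_vec unlift_none. Qed.

Lemma std_vec_sumE (d : 'I_m.+2 -> R) (l : 'I_m.+1) :
  (\sum_i d i *: std_vec i) 0 l = d (lift ord_max l) + d ord_max.
Proof.
rewrite big_ord_recr /= mxE std_vec_max; congr (_ + _).
  rewrite summxE (bigD1 l) //= big1 ?addr0 => [|j jl].
    by rewrite widen_ord_lift std_vec_lift !mxE !eqxx mulr1.
  by rewrite widen_ord_lift std_vec_lift !mxE eqxx eq_sym (negbTE jl) mulr0.
rewrite mxE summxE (bigD1 l) //= big1 ?addr0 => [|j jl].
  by rewrite !mxE !eqxx mulr1.
by rewrite !mxE eqxx eq_sym (negbTE jl).
Qed.

(** The set [I] misses two indices. Suppose that [a w + \sum_i d_i v_i = 0],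
    where [w] has coordinates 1, ..., m + 1, the [v_i] are the frame vectors,
    and [d_i = 0] for [i] not in [I]. The [l]th coordinate is the relation [E
    l], namely [a (l + 1) + d_l + d_max = 0]. If [I] misses two basis
    vectors, then subtracting the corresponding relations gives [a = 0]; if
    it misses the sum and one basis vector, then one relation already gives
    [a = 0]. All other coefficients then vanish. *)
Lemma staircase_free (I : {set 'I_m.+2}) : #|I| = m ->
  free ((\row_(i < m.+1) i.+1%:R : V) :: [seq std_vec i | i <- enum I]).
Proof.
move=> cI; apply/free_consP; first exact: enum_uniq.
move=> a c; rewrite big_enum /=.
pose d i := if i \in I then c i else 0.
have -> : \sum_(i in I) c i *: std_vec i = \sum_i d i *: std_vec i.
  rewrite [LHS]big_mkcond; apply: eq_bigr => i _ /=.
  by rewrite /d; case: ifP => //; rewrite scale0r.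
move=> /rowP E.
have {}E (l : 'I_m.+1) : a * l.+1%:R + d (lift ord_max l) + d ord_max = 0.
  by have := E l; rewrite mxE std_vec_sumE !mxE addrA.
suff [a0 dmax0] : a = 0 /\ d ord_max = 0.
  split=> // i; rewrite mem_enum => iI.
  have -> : c i = d i by rewrite /d iI.
  case: (unliftP ord_max i) => [l ->|-> //].
  by have := E l; rewrite a0 dmax0 mul0r add0r addr0.
have /card_gt1P[u [w [uI wI uw]]] : (1 < #|(~: I)%SET|)%N.
  suff -> : #|(~: I)%SET| = 2 by [].
  by apply: (@addnI m); rewrite -{1}cI cardsC card_ord addn2.
have dN i : i \in (~: I)%SET -> d i = 0 by rewrite inE /d => /negbTE ->.
have nz (l : nat) : l.+1%:R != 0 :> R by rewrite pnatr_eq0.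
have max0 l : d ord_max = 0 -> d (lift ord_max l) = 0 -> a = 0.
  move=> d0 dl; apply/eqP; have := E l; rewrite d0 dl !addr0 => /eqP.
  by rewrite mulf_eq0 (negbTE (nz _)) orbF.
move: (dN u uI) (dN w wI) uw.
case: (unliftP ord_max u) => [l ->|->]; last first.
  move=> d0; case: (unliftP ord_max w) => [l' ->|->]; last by rewrite eqxx.
  by move=> dl _; split=> //; exact: max0 dl.
case: (unliftP ord_max w) => [l' ->|->]; last first.
  by move=> dl d0 _; split=> //; exact: max0 dl.
move=> dl dl'; rewrite (inj_eq lift_inj) -val_eqE => /negbTE ll'.
have := E l; have := E l'; rewrite dl dl' !addr0 => E' E0.
have a0 : a = 0.
  apply/eqP; have : a * (l.+1%:R - l'.+1%:R) = 0.
    by apply/eqP; rewrite mulrBr subr_eq0 -(inj_eq (addIr (d ord_max))) E0 E'.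
  move/eqP; rewrite mulf_eq0 => /orP[/eqP //|].
  by rewrite subr_eq0 eqr_nat eqSS ll'.
by split=> //; move: E0; rewrite a0 mul0r add0r.
Qed.

End StandardFrame.

(** * Transformations of the projective space *)

Section ProjectiveSpace.
Local Open Scope quotient_scope.
Variables (R : realType) (m : nat).
Local Notation V := 'rV[R]_m.+1.
Local Notation RPm := (RP R m).
Implicit Types (x y : RPm) (u v : V).

Definition rep x : V := \val (repr x).

Lemma rep_neq0 x : rep x != 0.
Proof. exact: (set_mem (valP (repr x))). Qed.

(** The class of [v]. The value at the zero vector is arbitrary; having one
    makes [point] a function on the whole vector space, to which the limits
    of matrix expressions apply. *)
Definition point v : RPm :=
  if pselect (v != 0) is left v0 then Defs.proj v0
  else Defs.proj (e_neq0 R (@ord0 m)).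

Lemma point_proj v (v0 : v != 0) : point v = Defs.proj v0.
Proof.
rewrite /point; case: pselect => // h; congr Defs.proj.
exact: bool_irrelevance.
Qed.

Lemma eq_proj u v (u0 : u != 0) (v0 : v != 0) :
  <[u]>%VS = <[v]>%VS -> Defs.proj u0 = Defs.proj v0.
Proof.
move=> uv; apply: (elimT (@eqmodP _ (same_line_rel R m) _ _)).
by rewrite /= /same_line /= uv.
Qed.

Lemma eq_point u v : <[u]>%VS = <[v]>%VS -> point u = point v.
Proof.
move=> uv; have nz : (u == 0) = (v == 0) by rewrite -!memv0 !memvE uv.
rewrite /point; case: pselect => hu; case: pselect => hv //.
- exact: eq_proj.
- by case: hv; rewrite -nz.
- by case: hu; rewrite nz.
Qed.

Lemma repK x : point (rep x) = x.
Proof.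
rewrite (point_proj (rep_neq0 x)) -[RHS]reprK; congr (\pi_RPm).
exact: val_inj.
Qed.

Lemma rep_point v : v != 0 -> <[rep (point v)]>%VS = <[v]>%VS.
Proof.
move=> v0; rewrite (point_proj v0); apply/eqP.
have /eqmodP : repr (Defs.proj v0) = set_elt (A := [set v : V | v != 0]) v0
  %[mod {eq_quot same_line_rel R m}] by exact: reprK.
by [].
Qed.

Lemma line_mulmx u v (A : 'M[R]_m.+1) :
  <[u]>%VS = <[v]>%VS -> <[u *m A]>%VS = <[v *m A]>%VS.
Proof.
suff sub (a b : V) : <[a]>%VS = <[b]>%VS -> (<[a *m A]> <= <[b *m A]>)%VS.
  by move=> uv; apply/eqP; rewrite eqEsubv !sub.
move=> ab; have : a \in <[b]>%VS by rewrite -ab memv_line.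
by case/vlineP => c ->; rewrite -memvE -scalemxAl memvZ // memv_line.
Qed.

(** By definition of the quotient topology, the nonzero vectors whose class
    lies in an open set are the nonzero vectors of an open set [C], and [v]
    has a neighborhood of nonzero vectors. *)
Lemma point_continuous v : v != 0 -> {for v, continuous point}.
Proof.
move=> v0 B; rewrite nbhsE => -[B' [oB' B'v] B'B].
have [C oC CE] : open (\pi_RPm @^-1` B') by exact: oB'.
have Cv : C v.
  suff : (\pi_RPm @^-1` B') (set_elt (A := [set v : V | v != 0]) v0).
    by rewrite -CE.
  by rewrite /preimage /= -/(Defs.proj v0) -point_proj.
have nC : nbhs v C by exact: open_nbhs_nbhs.
have n0 : \forall u \near v, u != 0.
  by apply: (@near_mx_neq0 _ (nbhs v) _ _ _ _ id _ v0); exact: cvg_id.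
apply: (@filterS2 _ (nbhs v) _ _ _ _ _ nC n0) => u Cu u0; apply: B'B.
rewrite (point_proj u0).
suff : (\pi_RPm @^-1` B') (set_elt (A := [set v : V | v != 0]) u0) by [].
by rewrite -CE.
Qed.

(** The matrix of the orthogonal projection onto the line [x]. Unlike the
    representative [rep x], it does not depend on a choice, and hence it is
    continuous on the projective space. *)
Definition line_mx x : 'M[R]_m.+1 :=
  (sqnorm (rep x))^-1 *: ((rep x)^T *m rep x).

Lemma line_mx_continuous : continuous line_mx.
Proof.
pose g (u : nzvec R m) : 'M[R]_m.+1 :=
  (sqnorm (\val u))^-1 *: ((\val u)^T *m \val u).
suff cg : continuous g.
  apply: (@repr_comp_continuous _ {eq_quot same_line_rel R m} _ g cg).
  move=> u w /eqP /(introT (@eqmodP _ (same_line_rel R m) _ _)) /eqP uw.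
  apply/eqP.
  have : \val u \in <[\val w]>%VS by rewrite -uw memv_line.
  case/vlineP => c uE; rewrite /g uE sqnormZ.
  have c0 : c != 0.
    apply: contra_neq (set_mem (valP u)) => c0; apply/eqP.
    by rewrite uE c0 scale0r.
  rewrite [(c *: _)^T]linearZ /= -scalemxAl -scalemxAr !scalerA; congr (_ *: _).
  by rewrite -mulrA invfM mulrAC expr2 mulVf ?mul1r ?mulf_neq0.
move=> u; have u0 : \val u != 0 := set_mem (valP u).
have cu : \val w @[w --> nbhs u] --> \val u by exact: initial_continuous.
apply: (@cvg_scalemx _ (nbhs u)).
  apply: cvgV; first by rewrite lt0r_neq0 // sqnorm_gt0.
  apply: (@continuous_cvg _ _ _ (nbhs u)) => //; exact: sqnorm_continuous.
apply: (@cvg_mulmx _ (nbhs u)) => //.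
apply: cvg_mx => i j; rewrite mxE; under eq_fun do rewrite mxE.
exact: cvg_coord.
Qed.

(** On the open set of the lines where it does not vanish, the [j]th row of
    the projection matrix is a continuous choice of a representative: a local
    section of the quotient map. *)
Definition lift_row (j : 'I_m.+1) x : V := row j (line_mx x).

Lemma lift_row_continuous j : continuous (lift_row j).
Proof.
move=> x; apply: (@cvg_mx _ (nbhs x)) => i l; rewrite mxE.
under eq_fun do rewrite mxE.
by apply: (@cvg_coord _ (nbhs x)); exact: line_mx_continuous.
Qed.

Lemma lift_rowE j x : lift_row j x = ((sqnorm (rep x))^-1 * rep x 0 j) *: rep x.
Proof.
by apply/rowP => i; rewrite !mxE big_ord1 !mxE mulrA.
Qed.

Lemma lift_row_line j x :
  lift_row j x != 0 -> <[lift_row j x]>%VS = <[rep x]>%VS.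
Proof.
rewrite lift_rowE => h; apply: line_scale.
by apply: contra h => /eqP->; rewrite scale0r.
Qed.

Lemma exists_lift_row x : exists j, lift_row j x != 0.
Proof.
have /rV0Pn[j xj] := rep_neq0 x; exists j.
rewrite lift_rowE scaler_eq0 (negbTE (rep_neq0 x)) orbF mulf_neq0 //.
by rewrite invr_eq0 lt0r_neq0 // sqnorm_gt0 // rep_neq0.
Qed.

Definition act x (A : 'M[R]_m.+1) : RPm := point (rep x *m A).

Lemma act_point v A : v != 0 -> act (point v) A = point (v *m A).
Proof. by move=> v0; apply: eq_point; apply: line_mulmx; exact: rep_point. Qed.

Lemma actK x A B : A *m B = 1%:M -> A \in unitmx -> act (act x A) B = x.
Proof.
move=> AB uA; rewrite act_point -?mulmxA ?AB ?mulmx1 ?repK //.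
by apply: mulmx_unit_neq0 => //; exact: rep_neq0.
Qed.

(** Near [x], the representative [rep], which is not continuous, can be
    replaced with a nonvanishing [lift_row j] without changing [act]. *)
Lemma cvg_act (S : Type) (F : set_system S) {FF : Filter F} (f : S -> RPm)
    (g : S -> 'M[R]_m.+1) x (A : 'M[R]_m.+1) : A \in unitmx ->
  f s @[s --> F] --> x -> g s @[s --> F] --> A ->
  act (f s) (g s) @[s --> F] --> act x A.
Proof.
move=> uA fx gA; have [j xj] := exists_lift_row x.
have cl : lift_row j (f s) @[s --> F] --> lift_row j x.
  have lc : lift_row j y @[y --> x] --> lift_row j x.
    exact: lift_row_continuous.
  exact: (@cvg_comp _ _ _ f (lift_row j) F (nbhs x) _ fx lc).
have actE y B : lift_row j y != 0 -> act y B = point (lift_row j y *m B).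
  by move=> yj; apply/esym/eq_point/line_mulmx/lift_row_line.
rewrite actE //.
have : point (lift_row j (f s) *m g s) @[s --> F] --> point (lift_row j x *m A).
  apply: (@continuous_cvg _ _ _ F _ (fun s => lift_row j (f s) *m g s) point
    (lift_row j x *m A)).
    by apply: point_continuous; exact: mulmx_unit_neq0.
  exact: cvg_mulmx.
apply: cvg_trans; apply: near_eq_cvg.
apply: (@filterS _ F _ _ _ _ (near_mx_neq0 xj cl)) => s sj.
by rewrite actE.
Qed.

Lemma pfree_act (s : seq RPm) A : A \in unitmx ->
  pfree [seq act x A | x <- s] = pfree s.
Proof.
move=> uA; rewrite /pfree -map_comp -/rep.
rewrite (@eq_free_lines _ _ _ _ (fun x => rep x *m A)) => [|x /=].
  by rewrite -[RHS](free_mulmx _ uA) -map_comp.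
by apply: rep_point; apply: mulmx_unit_neq0 => //; exact: rep_neq0.
Qed.

End ProjectiveSpace.

(** * The projective bundle *)

Section ProjectiveBundle.
Variables (R : realType) (m : nat).
Local Notation V := 'rV[R]_m.+1.
Local Notation RPm := (RP R m).

Lemma cvg_frame_mx (S : Type) (F : set_system S) {FF : Filter F} (n : nat)
    (f : S -> {ptws 'I_n.+1 -> 'rV[R]_n}) (v : {ptws 'I_n.+1 -> 'rV[R]_n}) :
  base_mx v \in unitmx ->
  f s @[s --> F] --> v -> frame_mx (f s) @[s --> F] --> frame_mx v.
Proof.
move=> uv fv.
have fi i : f s i @[s --> F] --> v i by exact: (@cvg_ptws_coord _ F FF _ _ f).
have cb : base_mx (f s) @[s --> F] --> base_mx v.
  apply: cvg_mx => i j; rewrite mxE; under eq_fun do rewrite mxE.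
  exact: cvg_coord.
apply: cvg_mulmx => //; apply: cvg_mx => i j; rewrite mxE.
under eq_fun do rewrite mxE.
case: (i == j); rewrite ?mulr0n ?mulr1n; last exact: cvg_cst.
by apply: cvg_coord; apply: cvg_mulmx => //; exact: cvg_invmx.
Qed.

Lemma pfree_perm (s t : seq RPm) : perm_eq s t -> pfree s = pfree t.
Proof. by move=> st; apply: perm_free; exact: perm_map. Qed.

Lemma std_vec_neq0 i : std_vec R i != 0 :> V.
Proof.
rewrite /std_vec; case: unlift => [j|]; first exact: e_neq0.
exact: sum_e_neq0.
Qed.

Lemma std_frameE i : std_frame R m i = point (std_vec R i).
Proof.
rewrite /std_frame /std_vec; case: unlift => [j|]; apply/esym.
  exact: (point_proj (e_neq0 R j)).
exact: (point_proj (sum_e_neq0 R m)).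
Qed.

Definition staircase : V := \row_i i.+1%:R.

Lemma staircase_fiber :
  ([set: RPm] `\` Q (@pfree R m) m setT (std_frame R m)) (point staircase).
Proof.
have s0 : staircase != 0.
  by apply/rV0Pn; exists ord0; rewrite mxE oner_eq0.
split=> // -[I /= cI [_ /negP]]; apply.
pose w o : V := if o is Some i then std_vec R i else staircase.
have w0 o : w o != 0 by case: o => [i|] //=; exact: std_vec_neq0.
have -> : point staircase :: [seq std_frame R m i | i <- enum I] =
    [seq point (w o) | o <- None :: map Some (enum I)].
  rewrite /= -map_comp; congr (_ :: _); apply: eq_map => i /=.
  by rewrite std_frameE.
rewrite /pfree -map_comp (@eq_free_lines _ _ _ _ w) => [|o]; last first.
  exact: rep_point.
by rewrite /= -map_comp; exact: staircase_free.
Qed.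

(** The rows [J i] are chosen so that they represent the points of [p0]; by
    continuity they represent the points of all nearby [p], where [frame_mx]
    of these representatives depends continuously on [p]. *)
Lemma projective_chart (p0 : {ptws 'I_m.+2 -> RPm}) :
  W (@pfree R m) m.+1 m.+2 setT p0 ->
  exists U alpha beta,
    U p0 /\ frame_chart (@pfree R m) m.+1 setT (std_frame R m) U alpha beta.
Proof.
move=> Wp0.
have [J J0] := choice (fun i => exists_lift_row (p0 i)).
pose v (p : {ptws 'I_m.+2 -> RPm}) : {ptws 'I_m.+2 -> V} :=
  fun i => lift_row (J i) (p i).
pose U := [set p | forall i, v p i != 0].
have v_line p i : U p -> <[v p i]>%VS = <[rep (p i)]>%VS.
  by move=> Up; apply: lift_row_line; exact: Up.
have v_free p : U p -> W (@pfree R m) m.+1 m.+2 setT p ->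
    forall I : {set 'I_m.+2}, #|I| = m.+1 -> free [seq v p i | i <- enum I].
  move=> Up [_ Wp] I /Wp; rewrite /pfree -map_comp.
  rewrite (@eq_free_lines _ _ _ (v p) (fun i => rep (p i))) // => i.
  exact: v_line.
have cvg_v (S : Type) (F : set_system S) (FF : Filter F) f p :
    f s @[s --> F] --> p -> v (f s) @[s --> F] --> v p.
  move=> fp; apply: cvg_ptws => i.
  have fpi : f s i @[s --> F] --> p i by exact: (@cvg_ptws_coord _ F FF _ _ f).
  have lc : lift_row (J i) y @[y --> p i] --> lift_row (J i) (p i).
    exact: lift_row_continuous.
  exact: (@cvg_comp _ _ _ (fun s => f s i) (lift_row (J i)) F _ _ fpi lc).
have uA p : (U `&` W (@pfree R m) m.+1 m.+2 setT) p ->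
    frame_mx (v p) \in unitmx.
  by case=> Up Wp; apply: frame_mx_unit; exact: v_free.
have cvgA p x : (U `&` W (@pfree R m) m.+1 m.+2 setT) p ->
    frame_mx (v q.1) @[q --> (p, x : RPm)] --> frame_mx (v p).
  move=> [Up Wp]; apply: (@cvg_frame_mx _ (nbhs (p, x))).
    by apply: base_mx_unit; exact: v_free.
  by apply: (cvg_v _ (nbhs (p, x))); exact: cvg_fst.
exists U, (fun p x => act x (frame_mx (v p))),
  (fun p y => act y (invmx (frame_mx (v p)))).
split; first exact: J0.
split=> //.
- rewrite openE => p Up; rewrite /interior /U.
  apply: (@filter_forall _ _ _ (nbhs p)) => i.
  apply: (@near_mx_neq0 _ (nbhs p) _ _ _ _ (fun q => v q i) _ (Up i)).
  apply: (@cvg_ptws_coord _ (nbhs p) _ _ _ v).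
  by apply: (cvg_v _ (nbhs p)); exact: cvg_id.
- by move=> p s /uA; exact: pfree_act.
- move=> p i [Up Wp]; rewrite std_frameE act_point ?std_vec_neq0 //.
  rewrite -[RHS]repK; apply: eq_point; rewrite -(v_line _ _ Up).
  case: (unliftP ord_max i) => [j ->|->].
    rewrite std_vec_lift frame_mx_base line_scale //.
    exact: (frame_coord_neq0 (v_free _ Up Wp)).
  by rewrite std_vec_max (frame_mx_sum (v_free _ Up Wp)).
- by move=> p x /uA u _; apply: actK => //; exact: mulmxV.
- by move=> p x /uA u _; apply: actK; [exact: mulVmx|rewrite unitmx_inv].
- move=> p x Up _; apply: (@cvg_act _ _ _ (nbhs (p, x))).
  + exact: uA.
  + exact: cvg_snd.
  + exact: cvgA.
- move=> p x Up _; apply: (@cvg_act _ _ _ (nbhs (p, x))).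
  + by rewrite unitmx_inv; exact: uA.
  + exact: cvg_snd.
  + by apply: cvg_invmx; [exact: uA|exact: cvgA].
Qed.

Lemma projective_fiber_bundle :
  fiber_bundle ([set: RPm] `\` Q (@pfree R m) m setT (std_frame R m))
    (W_proj (@pfree R m) m.+1 m.+2 setT).
Proof.
apply: (fiber_bundle_of_charts pfree_perm) => //; last exact: projective_chart.
move=> p Wp; have [U [alpha [beta [Up ch]]]] := projective_chart Wp.
exists (alpha p (point staircase)).
exact/(chart_fib ch (conj Up Wp))/staircase_fiber.
Qed.

End ProjectiveBundle.

Theorem theorem1p1 (R : realType) (m : nat) (hm : (1 <= m)%N) (k n : nat)
    (hk : (1 <= k)%N) (hkn : (k <= n)%N) :
  (forall M : set 'rV[R]_m.+1, M = setT \/ M = sphere R m ->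
     (k = n /\ n = m) \/ (k = n /\ n = m.+1) ->
     fiber_bundle (M `\` Q vfree k.-1 M (b_ R m k)) (W_proj vfree k n M) /\
     exists s : W vfree k n M -> W vfree k n.+1 M,
       cross_section (W_proj vfree k n M) s) /\
  (k.+1 = n /\ n = m.+2 ->
     fiber_bundle ([set: RP R m] `\` Q (@pfree R m) m setT (std_frame R m))
       (W_proj (@pfree R m) k n setT)).
Proof.
split=> [M HM kn|[kn nm]]; last first.
  subst n; case: nm => km; subst k; exact: projective_fiber_bundle.
have [km -> {n kn hkn}] : (k <= m.+1)%N /\ n = k.
  by case: kn => -[-> ->]; rewrite ?leqnSn.
exact: vector_or_sphere_bundle.
Qed.
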